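(* The group $Sz(2)$ has four strong Gelfand subgroups; namely $Sz(2)$, $\mathrm{D}_{10}$, $\mathcal{C}_5$, and $\mathcal{C}_4$.
   Context: A strong Gelfand pair $(G,H)$ is a pair of finite groups $H \leq G$ such that $\langle \chi\downarrow H, \psi\rangle \leq 1$ for every irreducible complex character $\chi$ of $G$ and every irreducible complex character $\psi$ of $H$, where $\chi\downarrow H$ is the restriction of $\chi$ to $H$ and $\langle\cdot,\cdot\rangle$ is the usual inner product of class functions on $H$. In this case $H$ is called a strong Gelfand subgroup of $G$. The Suzuki group $Sz(2)$ is isomorphic to the Frobenius group $F_{20}\cong 5\colon 4$ of order $20$. Here $\mathrm{D}_{10}$ denotes the dihedral group of order $10$ and $\mathcal{C}_n$ denotes the cyclic group of order $n$. *)

(* Defs.v *)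
From HB Require Import structures.
From mathcomp Require Import all_boot all_order all_algebra.
From mathcomp Require Import all_fingroup all_solvable all_field all_character.

Set Implicit Arguments.
Unset Strict Implicit.
Unset Printing Implicit Defensive.

Import Order.TTheory GRing.Theory Num.Theory.
Local Open Scope ring_scope.

Definition strong_Gelfand (gT : finGroupType) (G H : {group gT}) : bool :=
  (H \subset G) &&
  [forall i : Iirr G, forall j : Iirr H, '['Res[H] 'chi[G]_i, 'chi[H]_j] <= 1].

Definition strong_Gelfand_classes (gT : finGroupType) (G : {group gT}) :
    {set {set {set gT}}} :=
  [set (H :^: G)%g | H : {group gT} & strong_Gelfand G H].

(* Suzuki's presentation of Sz(q), q = 2 ^ (2n + 1), as a subgroup of GL_4(q):
   the group generated by a Sylow 2-subgroup {S(a, b)}, a torus {M(l)} and an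
   involution T (Huppert-Blackburn, Finite Groups III, XI.3).  The automorphism
   theta : x |-> x ^ (2 ^ (n + 1)) is the square root of the Frobenius map when
   F has order 2 ^ (2n + 1), and x ^ (2 ^ n) is the inverse image of x under
   theta. *)
Section Suzuki.

Variables (F : finFieldType) (n : nat).
Implicit Types a b l x : F.

Definition mx4 (rows : seq (seq F)) : 'M[F]_4 :=
  \matrix_(i < 4, j < 4) nth 0 (nth [::] rows i) j.

Definition Sz_theta x : F := x ^+ (2 ^ n.+1).

Definition Sz_S a b : 'M[F]_4 := mx4
  [:: [:: 1; 0; 0; 0];
      [:: a; 1; 0; 0];
      [:: b; Sz_theta a; 1; 0];
      [:: a ^+ 2 * Sz_theta a + a * b + Sz_theta b; a * Sz_theta a + b; a; 1]].

Definition Sz_M l : 'M[F]_4 := mx4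
  [:: [:: l ^+ (2 ^ n).+1; 0; 0; 0];
      [:: 0; l ^+ (2 ^ n); 0; 0];
      [:: 0; 0; l ^- (2 ^ n); 0];
      [:: 0; 0; 0; l ^- (2 ^ n).+1]].

Definition Sz_T : 'M[F]_4 := mx4
  [:: [:: 0; 0; 0; 1];
      [:: 0; 0; 1; 0];
      [:: 0; 1; 0; 0];
      [:: 1; 0; 0; 0]].

Definition Sz_generators : {set {'GL_4[F]}} :=
  [set g : {'GL_4[F]} |
     [|| [exists a, exists b, GLval g == Sz_S a b],
         [exists l, (l != 0) && (GLval g == Sz_M l)]
       | GLval g == Sz_T]].

Definition Suzuki : {group {'GL_4[F]}} := <<Sz_generators>>%G.

End Suzuki.

Definition Sz2 : {group {'GL_4['F_2]}} := Suzuki 'F_2 0.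

(* Main.v *)
(**
  Sz(2) is a Frobenius group K ><| H with K of order 5 and H cyclic of order 4.
  Its irreducible characters are the linear ones, trivial on K, and those
  induced from nontrivial characters of K.  The former restrict irreducibly to
  every subgroup.  The latter restrict to H as its regular character, and by
  Frobenius reciprocity every nontrivial character of K occurs in their
  restriction at most once, the trivial one never.  So H and K are strong
  Gelfand, and so is every subgroup containing one of them.  Conversely, in a
  strong Gelfand pair (G, L) every irreducible degree of G is at most the sum of
  the irreducible degrees of L, hence at most #|L|; here this gives 4 <= #|L|,
  and such subgroups are the conjugates of H and the subgroups containing K.
*)
Require Import Defs.
From HB Require Import structures.
From mathcomp Require Import all_boot all_order all_algebra.
From mathcomp Require Import all_fingroup all_solvable all_field all_character.

Set Implicit Arguments.
Unset Strict Implicit.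
Unset Printing Implicit Defensive.

Import Order.TTheory GRing.Theory Num.Theory GroupScope.

(** * Restriction multiplicities in strong Gelfand pairs *)

Section StrongGelfand.

Local Open Scope ring_scope.

Variable gT : finGroupType.
Implicit Types G H K L : {group gT}.

Lemma strong_GelfandP G H :
  reflect (H \subset G /\
           forall (i : Iirr G) (j : Iirr H), '['Res[H] 'chi_i, 'chi_j] <= 1)
          (strong_Gelfand G H).
Proof.
apply: (iffP andP) => -[sHG le1]; split=> //.
  by move=> i j; have /forallP/(_ j) := forallP le1 i.
by apply/forallP=> i; apply/forallP=> j.
Qed.

(** For a constituent ['chi_k] of the restriction of ['chi_j] to [H], each copy of ['chi_j] in
    ['chi_i] restricted to [L] brings at least one copy of ['chi_k]. So the multiplicity of ['chi_j]
    is at most that of ['chi_k] in ['chi_i] restricted to [H]. *)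
Lemma strong_Gelfand_overgroup G H L :
  H \subset L -> L \subset G -> strong_Gelfand G H -> strong_Gelfand G L.
Proof.
move=> sHL sLG /strong_GelfandP[_ le1]; apply/strong_GelfandP; split=> // i j.
have [k] := constt_cfRes_irr H j; rewrite irr_consttE => nz_k.
have NResL := cfRes_char L (irr_char i).
have Njk := Cnat_cfdot_char_irr k (cfRes_char H (irr_char j)).
have Nij := Cnat_cfdot_char_irr j NResL.
apply: le_trans (le1 i k); rewrite -(cfResRes _ sHL sLG).
rewrite [X in 'Res[H, L] X]cfun_sum_cfdot linear_sum cfdot_suml /=.
rewrite (bigD1 j) //= linearZ cfdotZl -[leLHS]addr0 lerD //.
  rewrite ler_peMr ?natr_ge0 //; case/natrP: Njk nz_k => n ->.
  by rewrite pnatr_eq0 ler1n lt0n.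
apply: sumr_ge0 => l _; rewrite linearZ cfdotZl mulr_ge0 ?natr_ge0 //.
  exact: Cnat_cfdot_char_irr.
by apply/Cnat_cfdot_char_irr/cfRes_char/irr_char.
Qed.

Lemma strong_Gelfand_irr1_le G H i :
  strong_Gelfand G H -> 'chi[G]_i 1%g <= #|H|%:R.
Proof.
case/strong_GelfandP=> sHG le1; rewrite -(cfRes1 H).
(* The restriction is compared termwise with the regular character, in which ['chi_j] has
   multiplicity ['chi_j 1], which is at least 1. *)
have -> : #|H|%:R = cfReg H 1%g :> algC by rewrite cfRegE eqxx.
rewrite ['Res[H] 'chi_i]cfun_sum_cfdot cfReg_sum !sum_cfunE ler_sum // => j _.
rewrite !cfunE ler_wpM2r ?char1_ge0 ?irr_char //; apply: le_trans (le1 i j) _.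
by rewrite irr1_degree ler1n irr_degree_gt0.
Qed.

Lemma cfdot_Res_linear_le1 G L (xi : 'CF(G)) (j : Iirr L) :
  xi \is a linear_char -> '['Res[L] xi, 'chi_j] <= 1.
Proof.
move/(cfRes_lin_char L)/lin_char_irr/irrP=> [k ->].
by rewrite cfdot_irr lern1 leq_b1.
Qed.

(** * Frobenius groups with abelian complement or kernel *)

Section FrobeniusGroup.

Variables G K H : {group gT}.
Hypotheses (frobG : [Frobenius G = K ><| H]) (cHH : abelian H).

Let kerK : [Frobenius G with kernel K] := FrobeniusWker frobG.

Let nsKG : K <| G.
Proof. by have [/sdprod_context[]] := Frobenius_context frobG. Qed.

Let sHG : H \subset G.
Proof. by have [/sdprod_context[]] := Frobenius_context frobG. Qed.

(** The quotient by [K] is isomorphic to the abelian group [H], so [K] contains the derived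
    subgroup. *)
Lemma Frobenius_cfker_linear i :
  K \subset cfker 'chi[G]_i -> 'chi_i \is a linear_char.
Proof.
move=> kerKi; rewrite lin_irr_der1 (subset_trans _ kerKi) //.
rewrite der1_min ?normal_norm //.
by have [/sdprod_isog/isog_abelian<-] := Frobenius_context frobG.
Qed.

Lemma Frobenius_ker_strong_Gelfand : strong_Gelfand G K.
Proof.
apply/strong_GelfandP; split=> [|i j]; first exact: normal_sub.
have [kerKi | ] := boolP (K \subset cfker 'chi_i).
  exact/cfdot_Res_linear_le1/Frobenius_cfker_linear.
have [-> notker | nzj _] := eqVneq j 0.
  (* By Clifford's theorem, if the trivial character of the normal subgroup [K] occurs in the
     restriction, then [K] lies in the kernel. *)
  have [-> | nz] := eqVneq '['Res[K] 'chi_i, 'chi_0] 0; first exact: ler01.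
  by rewrite (constt0_Res_cfker nsKG nz) in notker.
have /irrP[k def_k] := irr_induced_Frobenius_ker kerK nzj.
by rewrite cfdot_Res_l def_k cfdot_irr lern1 leq_b1.
Qed.

Hypothesis cKK : abelian K.

(** The induced character vanishes off [K], which meets [H] only in 1, and its degree is the index
    of [K], that is [#|H|]. *)
Lemma Frobenius_Ind_compl_reg (k : Iirr K) :
  'Res[H] ('Ind[G] 'chi_k) = cfReg H.
Proof.
have [defG _ _ _ _] := Frobenius_context frobG.
have [_ _ defKH _ tiKH] := sdprod_context defG.
apply/cfun_inP=> x Hx; rewrite cfResE // cfRegE.
have [-> | ntx] := eqVneq x 1%g.
  rewrite cfInd1 ?normal_sub // -divgS ?normal_sub // -(sdprod_card defG).
  by rewrite mulKn ?cardG_gt0 // lin_char1 ?mulr1 //; apply/char_abelianP.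
apply: cfun_on0 (cfInd_normal _ nsKG) _; apply: contra ntx => Kx.
by rewrite -in_set1 -[[set _]]tiKH inE Kx.
Qed.

Lemma Frobenius_compl_strong_Gelfand : strong_Gelfand G H.
Proof.
apply/strong_GelfandP; split=> // i j.
have [kerKi | ] := boolP (K \subset cfker 'chi_i).
  exact/cfdot_Res_linear_le1/Frobenius_cfker_linear.
case/(Frobenius_Ind_irrP kerK)=> k _ ->; rewrite Frobenius_Ind_compl_reg.
rewrite cfReg_sum cfdot_suml (bigD1 j) //= big1 => [|l /negPf neq_lj].
  rewrite cfdotZl cfdot_irr eqxx addr0 mulr1 lin_char1 //.
  exact/char_abelianP.
by rewrite cfdotZl cfdot_irr neq_lj mulr0.
Qed.

Lemma Frobenius_strong_Gelfand_card L : strong_Gelfand G L -> (#|H| <= #|L|)%N.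
Proof.
have [_ ntK _ _ _] := Frobenius_context frobG.
(* The kernels of the irreducible characters of [K] intersect trivially, so they cannot all be
   [K]. *)
have [k nzk] : exists k : Iirr K, k != 0.
  apply/existsP; apply: contraR ntK; rewrite negb_exists => /forallP k0.
  rewrite -subG1 -(TI_cfker_irr K); apply/bigcapsP=> k _.
  by move/negbNE/eqP: (k0 k) => ->; rewrite cfker_irr0.
have /irrP[i def_i] := irr_induced_Frobenius_ker kerK nzk.
move/(strong_Gelfand_irr1_le i); rewrite -def_i -(cfRes1 H).
by rewrite Frobenius_Ind_compl_reg cfRegE eqxx ler_nat.
Qed.

End FrobeniusGroup.

End StrongGelfand.

(** * Conjugacy classes of subgroups *)

Lemma conjugates_conj_id (gT : finGroupType) (G : {group gT}) (A : {set gT}) x :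
  x \in G -> (A :^ x) :^: G = A :^: G.
Proof. by move=> Gx; rewrite conjugates_conj lcoset_id. Qed.

Lemma card_of_conjugates_eq (gT : finGroupType) (G : {group gT})
    (A B : {set gT}) :
  A :^: G = B :^: G -> #|A| = #|B|.
Proof.
move=> eqAB; have /imsetP[x _ ->] : A \in B :^: G.
  by rewrite -eqAB -{1}[A]conjsg1 imset_f.
by rewrite cardJg.
Qed.

(** * The Frobenius group of order 20, from generators and relations *)

Section Frobenius20.

Variables (gT : finGroupType) (x a : gT).
Hypotheses (x4 : x ^+ 4 = 1) (x2 : x ^+ 2 != 1).
Hypotheses (a5 : a ^+ 5 = 1) (nta : a != 1).
Hypothesis ax : a ^ x = a ^+ 3.

Let K := <[a]>%G.
Let H := <[x]>%G.
Let G := (K <*> H)%G.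
Let D := (K <*> <[x ^+ 2]>)%G.

Lemma F20_order5 : #[a] = 5.
Proof. exact: nt_prime_order. Qed.

Lemma F20_order4 : #[x] = 4.
Proof.
have ox_dvd4 : #[x] %| 4 by rewrite order_dvdn x4.
have ox_ndvd2 : ~~ (#[x] %| 2) by rewrite order_dvdn.
have: #[x] <= 4 by apply: dvdn_leq.
by case: #[x] ox_dvd4 ox_ndvd2 => [|[|[|[|[|n]]]]].
Qed.

Let oa := F20_order5.
Let ox := F20_order4.

Let conj_a_expg i : a ^ (x ^+ i) = a ^+ (3 ^ i)%N.
Proof.
elim: i => [|i IHi]; first by rewrite conjg1 expg1.
by rewrite expgSr conjgM IHi conjXg ax -expgM expnS.
Qed.

Let nKH : H \subset 'N(K).
Proof.
by rewrite cycle_subG inE -cycleJ ax cycle_subG mem_cycle.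
Qed.

(** Since 3 has order 4 modulo 5, no nontrivial power of [x] centralizes [a]; as [K] has prime
    order, the action of [H] is semiregular. *)
Let frobG : [Frobenius G = K ><| H].
Proof.
have tiKH : K :&: H = 1 by rewrite coprime_TIg // -!orderE oa ox.
have ntx : x != 1 by apply: contraNneq x2 => ->; rewrite expg1n.
apply/Frobenius_semiregularP; rewrite ?cycle_eq1 ?sdprodEY // => y.
case/setD1P=> nty /cyclePmin[i]; rewrite ox => lti4 def_y.
apply: prime_TIg; first by rewrite -orderE oa.
rewrite cycle_subG; apply: contra nty => /cent1P cay.
have : a ^+ (3 ^ i)%N == a ^+ 1.
  by rewrite -conj_a_expg -def_y expg1 conjgE cay mulKg.
rewrite eq_expg_mod_order oa def_y.
by case: i lti4 {def_y} => [|[|[|[|i]]]] //; rewrite expg0.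
Qed.

Let oG : #|G| = 20.
Proof.
by have [/sdprod_card<-] := Frobenius_context frobG; rewrite -!orderE oa ox.
Qed.

Let cHH : abelian H := cycle_abelian x.
Let cKK : abelian K := cycle_abelian a.

Lemma F20_strong_Gelfand_sub (L : {group gT}) : strong_Gelfand G L ->
  [\/ L :=: G, L :=: D, L :=: K | exists2 y, y \in G & L :=: H :^ y].
Proof.
move=> sgL; have [sLG _] := strong_GelfandP _ _ sgL.
have [defG _ _ _ _] := Frobenius_context frobG.
have [nsKG sHG defKH _ _] := sdprod_context defG.
have := Frobenius_strong_Gelfand_card frobG cKK sgL.
rewrite -orderE ox leq_eqVlt => /predU1P[/esym oL | gt4].
  (* Both [H] and [L] are Sylow 2-subgroups of [G]. *)
  constructor 4; apply: (@Sylow_trans 2); rewrite pHallE /= oG p_part.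
    by rewrite sHG -orderE ox.
  by rewrite sLG oL.
(* Otherwise K meets L trivially and #|K * L| = 5 * #|L| > 20. *)
have sKL : K \subset L.
  apply: contraTT (subset_leq_card (mul_subG (normal_sub nsKG) sLG)) => K'L.
  rewrite oG -ltnNge TI_cardMg ?prime_TIg -?orderE ?oa //.
  by rewrite -(@ltn_pmul2l 5) // in gt4; apply: leq_trans gt4.
(* By the modular law [L] is determined by its trace on the cyclic group [H], which has one subgroup
   for each of the orders 1, 2 and 4. *)
have defL : L :=: K * (H :&: L).
  by rewrite group_modl // defKH; apply/esym/setIidPr.
have: #|H :&: L| %| 4 by rewrite -ox cardSg ?subsetIl.
have eqHL n : n %| 4 -> #|H :&: L| = (4 %/ n)%N -> H :&: L = <[x ^+ n]>.
  move=> n4 oHL; apply/eqP.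
  rewrite (eq_subG_cyclic (cycle_cyclic x)) ?subsetIl //.
    by rewrite oHL -orderE orderXdiv ox.
  by rewrite cycle_subG mem_cycle.
have: #|H :&: L| > 0 := cardG_gt0 _.
have: #|H :&: L| <= 4 by rewrite -ox subset_leq_card ?subsetIl.
case oHL: #|_| => [|[|[|[|[|n]]]]] // _ _ _.
- by constructor 3; rewrite defL (eqHL 4) // x4 cycle1 mulg1.
- constructor 2; rewrite defL (eqHL 2) //= norm_joinEr //.
  by rewrite (subset_trans _ nKH) // cycle_subG mem_cycle.
- by constructor 1; rewrite defL (eqHL 1%N) //= expg1 -norm_joinEr.
Qed.

Let sDG : D \subset G.
Proof.
by rewrite join_subG joing_subl cycle_subG mem_gen // inE mem_cycle orbT.
Qed.

Let oD : #|D| = 10.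
Proof.
have sxH : <[x ^+ 2]> \subset H by rewrite cycle_subG mem_cycle.
have ox2 : #[x ^+ 2] = 2 by rewrite orderXdiv ox.
rewrite /= norm_joinEr ?(subset_trans sxH) // TI_cardMg -?orderE ?oa ?ox2 //.
by rewrite coprime_TIg // -!orderE oa ox2.
Qed.

Lemma F20_strong_Gelfand_classes :
  strong_Gelfand_classes G = [set G :^: G; D :^: G; K :^: G; H :^: G].
Proof.
have sgK := Frobenius_ker_strong_Gelfand frobG cHH.
apply/setP=> C; rewrite !inE -!orbA; apply/imsetP/idP=> [[L] | ].
  rewrite inE => /F20_strong_Gelfand_sub sgL ->.
  case: sgL => [-> | -> | -> | [y Gy ->]]; rewrite ?eqxx ?orbT //.
  by rewrite (conjugates_conj_id _ Gy) eqxx !orbT.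
case/or4P=> /eqP->; [exists G | exists D | exists K | exists H] => //;
  rewrite inE //.
- by apply: strong_Gelfand_overgroup sgK; rewrite ?joing_subl.
- by apply: strong_Gelfand_overgroup sgK; rewrite ?joing_subl.
- exact: Frobenius_compl_strong_Gelfand frobG cHH cKK.
Qed.

(** The four classes are told apart by the orders 20, 10, 5 and 4 of their members. *)
Lemma card_F20_strong_Gelfand_classes : #|strong_Gelfand_classes G| = 4.
Proof.
have neq (A B : {group gT}) : #|A| != #|B| -> (A :^: G == B :^: G) = false.
  by apply: contraNF => /eqP/card_of_conjugates_eq->.
rewrite F20_strong_Gelfand_classes -2!setUA cardsU1 !cardsU1 cards1 !inE.
by rewrite !neq // ?oG ?oD -?orderE ?oa ?ox.
Qed.

(** As 9 is -1 modulo 5, [x ^+ 2] inverts [a]. So the generators of [D] satisfy the dihedral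
    relations, and [D], a homomorphic image of ['D_10] of the same order, is isomorphic to it. *)
Lemma F20_dihedral_isog : D \isog 'D_10.
Proof.
rewrite isogEcard oD (@card_dihedral 5) // andbT (Grp_dihedral (q := 5)) //.
apply/existsP; exists (a, x ^+ 2) => /=.
rewrite !xpair_eqE eqxx a5 -expgM x4 eqxx /=.
by rewrite conj_a_expg eq_sym eq_invg_mul -expgS -order_dvdn oa.
Qed.

End Frobenius20.

(* Matrix products are locked; on lists of rows, identities between concrete
   matrices over 'F_2 can be decided by evaluation. *)
Section RowLists.

Variable F : finFieldType.
Implicit Types (A B : seq (seq F)) (g h : {'GL_4[F]}).

Definition row_entry A i j : F := nth 0%R (nth [::] A i) j.

Definition mul_rows A B : seq (seq F) :=
  let c := row_entry in
  mkseq (fun i => mkseq (fun j =>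
    (c A i 0 * c B 0 j + c A i 1 * c B 1 j
     + c A i 2 * c B 2 j + c A i 3 * c B 3 j)%R) 4) 4.

Definition unit_rows : seq (seq F) :=
  mkseq (fun i => mkseq (fun j => (i == j)%:R%R) 4) 4.

Lemma mx4M A B : (mx4 A *m mx4 B = mx4 (mul_rows A B))%R.
Proof.
apply/matrixP=> i j; rewrite !mxE !big_ord_recr big_ord0 /= !mxE add0r.
by rewrite !nth_mkseq.
Qed.

Lemma mx4_1 : mx4 unit_rows = (1%:M)%R.
Proof. by apply/matrixP=> i j; rewrite !mxE !nth_mkseq. Qed.

Lemma mx4_GL A B :
  mul_rows A B = unit_rows -> exists g : {'GL_4[F]}, GLval g = mx4 A.
Proof.
move=> AB1; suff [uA _] : mx4 A \in unitmx /\ mx4 B \in unitmx.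
  by exists (FinRing.Unit uA).
by apply: mulmx1_unit; rewrite mx4M AB1 mx4_1.
Qed.

Lemma mx4_GL1 : GLval (1 : {'GL_4[F]}) = mx4 unit_rows.
Proof. by rewrite mx4_1. Qed.

Lemma mx4_GLM g h A B :
  GLval g = mx4 A -> GLval h = mx4 B -> GLval (g * h) = mx4 (mul_rows A B).
Proof. by move=> gA hB; rewrite GL_MxE gA hB mx4M. Qed.

Lemma mx4_GLX g A n :
  GLval g = mx4 A -> GLval (g ^+ n) = mx4 (iter n (mul_rows A) unit_rows).
Proof.
move=> gA; elim: n => [|n IHn]; first exact: mx4_GL1.
by rewrite expgS (mx4_GLM gA IHn).
Qed.

Lemma mx4_GL_inj g h A B :
  GLval g = mx4 A -> GLval h = mx4 B -> A == B -> g = h.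
Proof. by move=> gA hB /eqP eqAB; apply: val_inj; rewrite /= gA eqAB -hB. Qed.

(** Different lists may give the same matrix, as [mx4] ignores entries out of range; hence a
    position inside the matrix is exhibited. *)
Lemma mx4_GL_neq (i j : 'I_4) g h A B :
    GLval g = mx4 A -> GLval h = mx4 B ->
  row_entry A i j != row_entry B i j -> g != h.
Proof.
move=> gA hB; apply: contraNneq => eq_gh.
by move/matrixP/(_ i j): gA; rewrite eq_gh hB !mxE => /esym/eqP.
Qed.

End RowLists.

(** * Generators and relations for Sz(2) *)

Lemma F2_cases (a : 'F_2) : (a = 0 \/ a = 1)%R.
Proof. by case: a => [[|[|n]] lt_n] //; [left | right]; apply: val_inj. Qed.

Lemma Sz2_generation : exists x a : {'GL_4['F_2]},
  [/\ x ^+ 4 = 1, x ^+ 2 != 1, a ^+ 5 = 1, a != 1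
    & a ^ x = a ^+ 3 /\ Sz2 = (<[a]> <*> <[x]>)%G].
Proof.
(* Squaring is the identity on ['F_2], so [Sz_theta] and the exponents disappear. *)
pose Srows (a b : 'F_2) : seq (seq 'F_2) :=
  ([:: [:: 1; 0; 0; 0]; [:: a; 1; 0; 0]; [:: b; a; 1; 0];
      [:: a + a * b + b; a + b; a; 1]])%R.
pose Trows : seq (seq 'F_2) :=
  ([:: [:: 0; 0; 0; 1]; [:: 0; 0; 1; 0]; [:: 0; 1; 0; 0]; [:: 1; 0; 0; 0]])%R.
have defS a b : Sz_S 0 a b = mx4 (Srows a b).
  rewrite /Sz_S; congr mx4; apply/eqP.
  by case: (F2_cases a) => ->; case: (F2_cases b) => ->; vm_compute.
(* S(1, 0) has order 4, with square S(0, 1) and inverse S(1, 1). *)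
have [x def_x] : exists x : {'GL_4['F_2]}, GLval x = mx4 (Srows 1 0)%R.
  by apply: (@mx4_GL _ _ (Srows 1 1)%R); apply/eqP; vm_compute.
have [t def_t] : exists t : {'GL_4['F_2]}, GLval t = mx4 Trows.
  by apply: (@mx4_GL _ _ Trows); apply/eqP; vm_compute.
(* In terms of Sz_S and Sz_T, a is S(0, 1) T. *)
pose a := x ^+ 2 * t; have def_a := mx4_GLM (mx4_GLX 2 def_x) def_t.
rewrite -/a in def_a.
have x4 : x ^+ 4 = 1.
  by apply: mx4_GL_inj (mx4_GLX 4 def_x) (mx4_GL1 _) _; vm_compute.
have a5 : a ^+ 5 = 1.
  by apply: mx4_GL_inj (mx4_GLX 5 def_a) (mx4_GL1 _) _; vm_compute.
have ax : a * x = x * a ^+ 3.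
  apply: mx4_GL_inj (mx4_GLM def_a def_x) (mx4_GLM def_x (mx4_GLX 3 def_a)) _.
  by vm_compute.
exists x, a; split=> //.
- apply: (mx4_GL_neq (i := 2%R) (j := 0%R) (mx4_GLX 2 def_x) (mx4_GL1 _) _).
  by vm_compute.
- by apply: (mx4_GL_neq (i := 0%R) (j := 0%R) def_a (mx4_GL1 _) _); vm_compute.
split; first by rewrite conjgE ax mulKg.
have def_Sz_T : Sz_T 'F_2 = mx4 Trows by [].
have inG y : y \in <[x]> -> y \in <[a]> <*> <[x]>.
  by apply/subsetP; rewrite joing_subr.
have inGa : a \in <[a]> <*> <[x]>.
  by apply: (subsetP (joing_subl _ _)); apply: cycle_id.
have x_gen : x \in Sz_generators 'F_2 0.
  rewrite inE; apply/or3P/Or31/existsP; exists 1%R; apply/existsP; exists 0%R.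
  by rewrite def_x defS.
have t_gen : t \in Sz_generators 'F_2 0 by rewrite inE def_t eqxx !orbT.
apply/val_inj/eqP; rewrite eqEsubset /= join_subG !cycle_subG gen_subG.
apply/and3P; split.
- apply/subsetP=> g; rewrite inE => /or3P[].
  (* The four matrices S(b, c) are exactly the powers of [x]. *)
  + case/existsP=> b /existsP[c /eqP]; rewrite defS => def_g.
    suff [n ->] : exists n, g = x ^+ n by apply/inG/mem_cycle.
    case: (F2_cases b) def_g => ->; case: (F2_cases c) => -> def_g;
      [exists 0 | exists 2 | exists 1%N | exists 3];
      by apply: mx4_GL_inj def_g (mx4_GLX _ def_x) _; vm_compute.
  (* The torus is trivial, because 1 is the only nonzero scalar. *)
  + case/existsP=> l /andP[nzl /eqP def_g].
    case: (F2_cases l) nzl def_g => ->; rewrite ?eqxx // => _ def_g.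
    suff -> : g = 1 by apply: group1.
    by apply: mx4_GL_inj def_g (mx4_GL1 _) _; vm_compute.
  rewrite def_Sz_T => /eqP def_g.
  (* Here [a] is [x ^+ 2 * t] and [x ^+ 2] is its own inverse. *)
  suff -> : g = x ^+ 2 * a by rewrite groupM // inG // mem_cycle.
  by apply: mx4_GL_inj def_g (mx4_GLM (mx4_GLX 2 def_x) def_a) _; vm_compute.
- by rewrite groupM ?groupX // mem_gen.
exact: mem_gen.
Qed.

Theorem theorem3p5 :
  #|strong_Gelfand_classes Sz2| = 4%N /\
  exists D10 C5 C4 : {group {'GL_4['F_2]}},
    [/\ (D10 \isog 'D_10)%g,
        (C5 \isog Zp 5)%g,
        (C4 \isog Zp 4)%g
      & strong_Gelfand_classes Sz2 =
          [set (Sz2 :^: Sz2)%g; (D10 :^: Sz2)%g; (C5 :^: Sz2)%g;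
               (C4 :^: Sz2)%g]].
Proof.
have [x [a [x4 x2 a5 nta [ax ->]]]] := Sz2_generation.
split; first exact: card_F20_strong_Gelfand_classes.
exists (<[a]> <*> <[x ^+ 2]>)%G, <[a]>%G, <[x]>%G; split.
- exact: F20_dihedral_isog.
- by have := Zp_isog a; rewrite (F20_order5 a5 nta) isog_sym.
- by have := Zp_isog x; rewrite (F20_order4 x4 x2) isog_sym.
- exact: F20_strong_Gelfand_classes.
Qed.
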